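(* The boolean Parity Ising interaction family $\mathfrak{I}^{\mathrm{B\text{-}Par\text{-}Is}}$ is functionally representable, contraction-closed, group--coset, and globally satisfiable.
   Context: The boolean Parity Ising family $\mathfrak{I}^{\mathrm{B\text{-}Par\text{-}Is}}=(S,\{\Phi^k\}_{k\ge0})$ has spin value set $S=\mathbb{Z}/2\mathbb{Z}$ and $\Phi^k(s_1,\dots,s_k)=1$ if $\sum_{i=1}^ks_i\equiv0\pmod2$, and $0$ otherwise. For an interaction family $(S,\{\Phi^k\}_{k\ge0})$ with $S$ finite and permutation-invariant $\Phi^k\colon S^k\to\{0,1\}$, put $K_{\Phi^k}=\{\boldsymbol{s}\in S^k\mid\Phi^k(\boldsymbol{s})=1\}$, and for $A\subseteq[k]$ let $\boldsymbol{s}|_A=(s_i)_{i\in A}$. Functionally representable: for every $k$ there is a partition $[k]=I\sqcup D$ and a map $\sigma\colon S^{|I|}\to S^{|D|}$ (dependency map) with $K_{\Phi^k}=\{(\boldsymbol{s}_I,\sigma(\boldsymbol{s}_I))\mid\boldsymbol{s}_I\in S^{|I|}\}$ ($\boldsymbol{s}_I$ placed on $I$, $\sigma(\boldsymbol{s}_I)$ on $D$). Contraction-closed (for a functionally representable family): for every $k$, every $k'\ge k$ and every partition $[k]=I\sqcup D$ with a map $\sigma\colon S^{|I|}\to S^{|D|}$ satisfying $K_{\Phi^k}=\{(\boldsymbol{s}_I,\sigma(\boldsymbol{s}_I))\mid\boldsymbol{s}_I\in S^{|I|}\}$ ($\boldsymbol{s}_I$ placed on $I$, $\sigma(\boldsymbol{s}_I)$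 on $D$), let $\hat\sigma\colon S^{[k']\setminus D}\to S^{[k']}$, $\hat\sigma(\boldsymbol{s})|_{[k']\setminus D}=\boldsymbol{s}$, $\hat\sigma(\boldsymbol{s})|_D=\sigma(\boldsymbol{s}|_I)$; then for every $A\subseteq[k']$ either $\Phi^{|A|}(\hat\sigma(\boldsymbol{s})|_A)$ is constant in $\boldsymbol{s}$, or there is a unique $A'\subseteq[k']\setminus D$ with $\Phi^{|A|}(\hat\sigma(\boldsymbol{s})|_A)=\Phi^{|A'|}(\boldsymbol{s}|_{A'})$ for all $\boldsymbol{s}\in S^{[k']\setminus D}$. Group--coset: $S$ is a finite group and, for all $k\ge0$, $K_{\Phi^k}$ is a coset of a subgroup of $S^k$. Globally satisfiable: there is $s\in S$ with $\Phi^k(s,\dots,s)=1$ for all $k$. *)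

(* Defs.v *)
From HB Require Import structures.
From mathcomp Require Import all_boot all_order all_algebra all_fingroup.

Set Implicit Arguments.
Unset Strict Implicit.
Unset Printing Implicit Defensive.

Record interaction_family (S : finType) := InteractionFamily {
  phi :> forall k : nat, {ffun 'I_k -> S} -> bool;
  _ : forall k (p : 'S_k) (s : {ffun 'I_k -> S}),
        phi [ffun i => s (p i)] = phi s
}.

Section Family.
Variable S : finType.
Implicit Types F : interaction_family S.

Definition sat_set F (k : nat) : {set {ffun 'I_k -> S}} := [set s | F k s].

(* [restr s A] is (s_i)_{i in A}, read as an element of S^{|A|} through the
   enumeration of A; for 'I_k this is the increasing one, and the order is
   irrelevant inside a permutation-invariant interaction. *)
Definition restr (T : finType) (s : {ffun T -> S}) (A : {set T})
  : {ffun 'I_#|A| -> S} := [ffun i => s (enum_val i)].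

(* A partition [k] = I |_| D is given by D, with I = ~: D. A configuration t
   is (x, sigma x) when it restricts to x on I and to sigma x on D. *)
Definition dependency_map F (k : nat) (D : {set 'I_k})
    (sigma : {ffun 'I_#|~: D| -> S} -> {ffun 'I_#|D| -> S}) : Prop :=
  sat_set F k =
  [set t | [exists x, (restr t (~: D) == x) && (restr t D == sigma x)]].

Definition functionally_representable F : Prop :=
  forall k, exists (D : {set 'I_k})
    (sigma : {ffun 'I_#|~: D| -> S} -> {ffun 'I_#|D| -> S}),
    dependency_map F sigma.

Section Hat.
Variables (k k' : nat) (le_k_k' : k <= k') (D : {set 'I_k}).

(* [k'] \ D, where D is a subset of [k] and [k] the initial segment of [k']. *)
Definition free_set : {set 'I_k'} :=
  ~: [set widen_ord le_k_k' d | d in D].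

Lemma widen_free (j : 'I_#|~: D|) :
  widen_ord le_k_k' (enum_val j) \in free_set.
Proof.
have:= enum_valP j; rewrite !inE; apply: contra => /imsetP[d dD eq_jd].
by rewrite (_ : enum_val j = d) //; apply/val_inj; have:= congr1 val eq_jd.
Qed.

Definition indep_index (j : 'I_#|~: D|) : {i | i \in free_set} :=
  exist _ (widen_ord le_k_k' (enum_val j)) (widen_free j).

Lemma dep_or_free (i : 'I_k') :
  {j : 'I_#|D| | widen_ord le_k_k' (enum_val j) = i} + {i \in free_set}.
Proof.
case: (pickP (fun j : 'I_#|D| => widen_ord le_k_k' (enum_val j) == i)).
  by move=> j /eqP; left; exists j.
move=> noj; right; rewrite inE; apply/imsetP => -[d dD eq_id].
by have:= noj (enum_rank_in dD d); rewrite enum_rankK_in // eq_id eqxx.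
Qed.

Variable sigma : {ffun 'I_#|~: D| -> S} -> {ffun 'I_#|D| -> S}.

Definition hat (s : {ffun {i | i \in free_set} -> S}) : {ffun 'I_k' -> S} :=
  [ffun i => match dep_or_free i with
             | inleft (exist j _) => sigma [ffun l => s (indep_index l)] j
             | inright i_free => s (exist _ i i_free)
             end].

(* hat is determined by its values on [k'] \ D and on D: *)
Lemma hat_free s (i : {i | i \in free_set}) : hat s (val i) = s i.
Proof.
rewrite ffunE; case: dep_or_free => [[j eq_ji] | i_free].
  have:= valP i; rewrite inE => /imsetP[].
  by exists (enum_val j); rewrite ?enum_valP.
by congr (s _); apply: val_inj.
Qed.

Lemma hat_dep s (j : 'I_#|D|) :
  hat s (widen_ord le_k_k' (enum_val j)) =
  sigma [ffun l => s (indep_index l)] j.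
Proof.
rewrite ffunE; case: dep_or_free => [[j' eq_j'j] | j_free]; last first.
  have:= j_free; rewrite inE => /imsetP[].
  by exists (enum_val j); rewrite ?enum_valP.
congr (sigma _ _); apply/enum_val_inj/val_inj.
by have:= congr1 val eq_j'j.
Qed.

End Hat.

Definition contraction_closed F : Prop :=
  forall (k k' : nat) (le_k_k' : k <= k') (D : {set 'I_k})
    (sigma : {ffun 'I_#|~: D| -> S} -> {ffun 'I_#|D| -> S}),
    dependency_map F sigma ->
  forall A : {set 'I_k'},
    (exists b : bool, forall s : {ffun {i | i \in free_set le_k_k' D} -> S},
       F #|A| (restr (hat sigma s) A) = b)
    \/
    (exists! A' : {set {i | i \in free_set le_k_k' D}},
       forall s : {ffun {i | i \in free_set le_k_k' D} -> S},
         F #|A| (restr (hat sigma s) A) = F #|A'| (restr s A')).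

Definition globally_satisfiable F : Prop :=
  exists s : S, forall k, F k [ffun=> s].

End Family.

(* MathComp puts the product group structure on the {dffun _} alias of
   {ffun 'I_k -> gT}. *)
Definition group_coset (gT : finGroupType) (F : interaction_family gT) : Prop :=
  forall k, exists (H : {group {dffun forall _ : 'I_k, gT}})
                   (g : {dffun forall _ : 'I_k, gT}),
    [set s : {dffun forall _ : 'I_k, gT} | F k s] = (g *: H)%g.

Definition parity (k : nat) (s : {ffun 'I_k -> 'Z_2}) : bool :=
  (\sum_i s i == 0)%R.

Lemma parity_perm k (p : 'S_k) (s : {ffun 'I_k -> 'Z_2}) :
  parity [ffun i => s (p i)] = parity s.
Proof.
rewrite /parity [in RHS](reindex_inj (@perm_inj _ p)) /=.
by under eq_bigr do rewrite ffunE.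
Qed.

Definition parity_ising : interaction_family 'Z_2 :=
  InteractionFamily parity_perm.

(* Main.v *)
Require Import Defs.
From mathcomp Require Import all_boot all_order all_algebra all_fingroup.

(** All four properties are linear algebra over [Z/2]. The configurations
    satisfying [parity] form the kernel of the linear form [s |-> \sum_i s i],
    which gives the group--coset property (a kernel is a subgroup) and global
    satisfiability (it contains [0]). Solving the equation for one coordinate
    gives functional representability.

    For contraction-closedness, let [sigma] be any dependency map with dependent
    set [D]. A satisfying configuration is determined by its values off [D],
    while flipping two coordinates preserves satisfaction, so [D] has at most
    one element. Extending a free configuration by [sigma] produces a [hat] with
    zero sum over the initial segment [[k]], so the sum of [hat] over [A] equals
    its sum over the symmetric difference of [A] and [[k]]. One of these two sets
    avoids [D] ([contract]), and over it the sum only sees free coordinates: this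
    is the set [A'] ([parity_contract]). It is unique because the form
    [s |-> \sum_(i in B) s i] recovers [B] when evaluated on indicators
    ([parity_restr_inj]). *)

Set Implicit Arguments.
Unset Strict Implicit.
Unset Printing Implicit Defensive.

Import GRing.Theory.
Local Open Scope ring_scope.

Section DependencyMaps.
Variables (S : finType) (F : interaction_family S) (k : nat) (D : {set 'I_k}).
Variable sigma : {ffun 'I_#|~: D| -> S} -> {ffun 'I_#|D| -> S}.
Hypothesis sigmaP : dependency_map F sigma.

Lemma dependency_mapP (t : {ffun 'I_k -> S}) :
  F k t = (restr t D == sigma (restr t (~: D))).
Proof.
have /setP/(_ t) := sigmaP; rewrite !inE => ->.
by apply/existsP/eqP => [[x /andP[/eqP-> /eqP]] | tD] //; exists (restr t (~: D));
  rewrite eqxx tD /=.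
Qed.

Lemma dependency_map_inj (t u : {ffun 'I_k -> S}) :
  F k t -> F k u -> {in ~: D, t =1 u} -> {in D, t =1 u}.
Proof.
rewrite !dependency_mapP => /eqP tD /eqP uD tu d dD.
have: restr t D = restr u D.
  rewrite tD uD; congr (sigma _); apply/ffunP => j.
  by rewrite !ffunE tu // enum_valP.
by move/ffunP/(_ (enum_rank_in dD d)); rewrite !ffunE enum_rankK_in.
Qed.

Lemma hat_sat (k' : nat) (le_k_k' : (k <= k')%N)
    (s : {ffun {i | i \in free_set le_k_k' D} -> S}) :
  F k [ffun i => hat sigma s (widen_ord le_k_k' i)].
Proof.
rewrite dependency_mapP; apply/eqP/ffunP => j.
rewrite [LHS]ffunE [LHS]ffunE hat_dep; congr (sigma _ _); apply/ffunP => l.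
by rewrite [LHS]ffunE [RHS]ffunE [RHS]ffunE -(hat_free sigma).
Qed.

End DependencyMaps.

Lemma addZ2_self (x : 'Z_2) : x + x = 0.
Proof. by apply/val_inj; case: x => [[|[|]]]. Qed.

Lemma addZ2_eq0 (x y : 'Z_2) : (x + y == 0) = (x == y).
Proof. by rewrite -(addZ2_self y) (inj_eq (addIr y)). Qed.

Lemma parity_restr (T : finType) (s : {ffun T -> 'Z_2}) (A : {set T}) :
  parity (restr s A) = (\sum_(i in A) s i == 0).
Proof.
by rewrite /parity [in RHS]big_enum_val; under eq_bigr do rewrite ffunE.
Qed.

(** The indicator of [x] has nonzero sum over a set exactly when [x] lies in
    it. *)
Lemma parity_restr_inj (T : finType) (A B : {set T}) :
  (forall s : {ffun T -> 'Z_2}, parity (restr s A) = parity (restr s B)) ->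
  A = B.
Proof.
move=> eqAB; apply/setP => x.
have ind (C : {set T}) :
    parity (restr [ffun i => if i == x then 1 else 0 : 'Z_2] C) = (x \notin C).
  rewrite parity_restr; case: (boolP (x \in C)) => xC.
    rewrite (bigD1 x) //= ffunE eqxx big1 ?addr0 // => i /andP[_ /negPf ix].
    by rewrite ffunE ix.
  rewrite big1 ?eqxx // => i iC; rewrite ffunE.
  by case: eqP => // ix; rewrite -ix iC in xC.
by apply: negb_inj; rewrite -!ind.
Qed.

(** Elements common to [A] and [B] are counted twice on the right, hence
    cancel. *)
Lemma sum_symdiff (T : finType) (s : {ffun T -> 'Z_2}) (A B : {set T}) :
  \sum_(i in [set i | (i \in A) (+) (i \in B)]) s i =
  \sum_(i in A) s i + \sum_(i in B) s i.
Proof.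
rewrite !(big_mkcond (fun i => i \in _)) -big_split.
apply: eq_bigr => i _; rewrite inE.
by do 2!case: (i \in _); rewrite /= ?addZ2_self ?addr0 ?add0r.
Qed.

Lemma parity_functionally_representable :
  functionally_representable parity_ising.
Proof.
case=> [|k].
  (* The empty sum is zero: nothing is constrained and nothing is dependent. *)
  exists set0, (fun=> [ffun=> 0]); apply/setP => t; rewrite !inE /= /parity.
  rewrite big_ord0 eqxx; apply/esym/existsP; exists (restr t (~: set0)).
  by rewrite eqxx /=; apply/eqP/ffunP => j; have := enum_valP j; rewrite inE.
exists [set ord0], (fun x => [ffun=> \sum_i x i]).
apply/setP => t; rewrite !inE /= /parity.
have sumD : \sum_i restr t (~: [set ord0]) i = \sum_(i | i != ord0) t i.
  transitivity (\sum_(i in ~: [set ord0]) t i).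
    by rewrite [in RHS]big_enum_val; under eq_bigr do rewrite ffunE.
  by apply: eq_bigl => i; rewrite !inE.
rewrite (bigD1 ord0) //= -sumD addZ2_eq0.
apply/eqP/existsP => [t0 | [x /andP[/eqP-> /eqP/ffunP eqD]]].
  exists (restr t (~: [set ord0])); rewrite eqxx /=.
  apply/eqP/ffunP => j; rewrite !ffunE.
  by have := enum_valP j; rewrite inE => /eqP ->.
have := eqD (enum_rank_in (set11 ord0) ord0).
by rewrite !ffunE enum_rankK_in ?set11.
Qed.

(** If [D] had two elements, flipping both of them in the zero configuration
    would give a second satisfying configuration with the same free values. *)
Lemma parity_dependent_unique k (D : {set 'I_k})
    (sigma : {ffun 'I_#|~: D| -> 'Z_2} -> {ffun 'I_#|D| -> 'Z_2}) :
  dependency_map parity_ising sigma -> {in D &, forall d e, d = e}.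
Proof.
move=> sigmaP d e dD eD; apply/eqP; apply: contraT => de.
pose u : {ffun 'I_k -> 'Z_2} := [ffun i => if i \in [set d; e] then 1 else 0].
have uK : parity_ising k u.
  rewrite /= /parity; under eq_bigr do rewrite ffunE.
  by rewrite -big_mkcond big_setU1 ?inE //= big_set1 addZ2_self.
have zK : parity_ising k [ffun=> 0].
  by rewrite /= /parity big1 // => i _; rewrite ffunE.
have /(_ _ d dD) := dependency_map_inj sigmaP uK zK.
rewrite !ffunE !inE eqxx /= => absurd.
suff /absurd : {in ~: D, u =1 [ffun=> 0]} by [].
move=> i; rewrite !ffunE !inE; case: eqP => [-> | _]; first by rewrite dD.
by case: eqP => [-> | _] //; rewrite eD.
Qed.

Section Contraction.
Variables (k k' : nat) (le_k_k' : (k <= k')%N) (D : {set 'I_k}).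
Variable sigma : {ffun 'I_#|~: D| -> 'Z_2} -> {ffun 'I_#|D| -> 'Z_2}.
Hypothesis sigmaP : dependency_map parity_ising sigma.
Let free := {i | i \in free_set le_k_k' D}.
Let widen := widen_ord le_k_k'.

(** When [A] meets [D], adding the equation that defines the dependent variable
    eliminates this variable from the sum over [A]. *)
Definition contract (A : {set 'I_k'}) : {set 'I_k'} :=
  if [disjoint A & widen @: D] then A
  else [set i | (i \in A) (+) (i \in [set widen j | j in 'I_k])].

Lemma contract_free A : contract A \subset free_set le_k_k' D.
Proof.
rewrite /free_set -disjoints_subset /contract; case: ifP => // /negbT.
case/pred0Pn=> x /= /andP[+ /imsetP[d dD def_x]]; rewrite {x}def_x => dA.
apply/pred0P => i; apply/negP => /= /andP[+ /imsetP[e eD def_i]].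
rewrite {i}def_i inE (parity_dependent_unique sigmaP eD dD) dA.
by rewrite imset_f.
Qed.

Lemma sum_hat_contract (A : {set 'I_k'}) (s : {ffun free -> 'Z_2}) :
  \sum_(i in contract A) hat sigma s i = \sum_(i in A) hat sigma s i.
Proof.
rewrite /contract; case: ifP => // _; rewrite sum_symdiff.
rewrite [X in _ + X]big_imset /=; last first.
  by move=> i j _ _ /(congr1 val) /= /val_inj.
have /eqP sum0 := hat_sat sigmaP s.
by rewrite (eq_bigr _ (fun i _ => ffunE _ i)) in sum0; rewrite sum0 addr0.
Qed.

Lemma sum_hat_free (B : {set 'I_k'}) (s : {ffun free -> 'Z_2}) :
  B \subset free_set le_k_k' D ->
  \sum_(i in B) hat sigma s i = \sum_(x in [set x : free | val x \in B]) s x.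
Proof.
move=> /subsetP sBfree.
have -> : B = [set val x | x in [set x : free | val x \in B]].
  apply/setP => i; apply/idP/imsetP => [iB | [x]]; last by rewrite inE => ? ->.
  by exists (exist _ i (sBfree i iB)); rewrite ?inE.
rewrite big_imset /=; last by move=> x y _ _ /val_inj.
apply: eq_big => [x | x _]; last exact: hat_free.
by rewrite !inE (mem_imset _ _ val_inj) inE.
Qed.

Lemma parity_contract (A : {set 'I_k'}) (s : {ffun free -> 'Z_2}) :
  parity (restr (hat sigma s) A) =
  parity (restr s [set x : free | val x \in contract A]).
Proof.
by rewrite !parity_restr -sum_hat_contract sum_hat_free ?contract_free.
Qed.

End Contraction.

(** The second alternative always holds: a contracted interaction that is
    constant is the parity of the empty set of free coordinates. *)
Lemma parity_contraction_closed : contraction_closed parity_ising.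
Proof.
move=> k k' le_k_k' D sigma sigmaP A; right.
exists [set x | val x \in contract le_k_k' D A].
split=> [s | B eqB]; first exact: (parity_contract sigmaP).
apply: parity_restr_inj => s.
by rewrite -(parity_contract sigmaP); exact: eqB.
Qed.

Lemma parity_group_coset : group_coset parity_ising.
Proof.
move=> k.
pose K := [set s : {dffun forall _ : 'I_k, 'Z_2} | parity_ising k s].
have groupK : group_set K.
  apply/group_setP; split=> [|s t]; rewrite !inE /= /parity.
    by rewrite big1 // => i _; rewrite ffunE.
  move=> /eqP s0 /eqP t0; under eq_bigr do rewrite ffunE.
  by rewrite big_split /= s0 t0 addr0.
by exists (group groupK), 1%g; rewrite mul1g.
Qed.

Lemma parity_globally_satisfiable : globally_satisfiable parity_ising.
Proof.
by exists 0 => k; rewrite /= /parity big1 // => i _; rewrite ffunE.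
Qed.

Theorem proposition5p5 :
  [/\ functionally_representable parity_ising,
      contraction_closed parity_ising,
      group_coset parity_ising
    & globally_satisfiable parity_ising].
Proof.
split; [exact: parity_functionally_representable
      | exact: parity_contraction_closed
      | exact: parity_group_coset
      | exact: parity_globally_satisfiable].
Qed.
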